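(* Let $q=2^h$ and $q'=2^{h-i}$ with $1\le i<h$ and $h-i\mid h$, let $L$ be the relative trace function from $\mathbb{F}_{q}$ to $\mathbb{F}_{q'}$, and let $g:\mathbb{F}_{q'}\to\mathbb{F}_{q'}$ be an $o$-polynomial. Then the KM-arc $\mathcal{A}_{km}$ of type $2^i$ in $\mathrm{PG}(2,q)$ with affine point set $\{(1,g(L(x)),x)\mid x\in\mathbb{F}_q\}$ is an elation KM-arc.
   Context: Points of $\mathrm{PG}(2,q)$ have homogeneous coordinates $(X,Y,Z)$; affine points are those not on $X=0$. A KM-arc of type $t$ in $\mathrm{PG}(2,q)$ is a set of $q+t$ points such that every line meets it in $0$, $2$ or $t$ points (each value occurring); a line meeting it in $i$ points is an $i$-secant. A hyperoval is a KM-arc of type $2$. If $t>2$, all $t$-secants pass through one common point, the $t$-nucleus. An $o$-polynomial $g$ over $\mathbb{F}_{q'}$ is one such that $\{(1,g(x),x)\mid x\in\mathbb{F}_{q'}\}\cup\{(0,1,0),(0,0,1)\}$ is a hyperoval of $\mathrm{PG}(2,q')$. Known (Korchmáros–Mazzocca): the point set $\{(1,g(L(x)),x)\mid x\in\mathbb{F}_{q}\}$ can uniquely be extended (by points on $X=0$) to a KM-arc $\mathcal{A}_{km}$ of type $2^{i}$ in $\mathrm{PG}(2,q)$, with $2^i$-nucleus $(0,0,1)$. An elation with axis a line $\ell$ and centre a point $R\in\ell$ is a collineation fixing all points of $\ell$ and stabilising all lines through $R$. A KM-arc $\mathcal{A}$ of type $t>2$ is an elation KM-arc with elation line $\ell_\infty$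 if for every $t$-secant $\ell\neq\ell_\infty$ the group of elations with axis $\ell_\infty$ stabilising $\mathcal{A}$ is transitive on the points of $\mathcal{A}\cap\ell$ (any point of $\mathcal{A}\cap\ell$ can be mapped to any other one by an element of the group). A hyperoval is an elation KM-arc with elation line $\ell_\infty$ if it is stabilised by a non-trivial elation with axis $\ell_\infty$. An elation KM-arc is one for which such a line $\ell_\infty$ exists. *)

(* Defs.v *)
From mathcomp Require Import all_boot all_order all_fingroup all_algebra all_field.

Set Implicit Arguments.
Unset Strict Implicit.
Unset Printing Implicit Defensive.

Import GRing.Theory.
Local Open Scope ring_scope.

Section ProjectivePlane.
Variable F : finFieldType.

(* The points and lines of PG(2,q) are the row spaces of dimension 1 and 2 of
   F^3, each represented by its canonical generating matrix <<A>>, so that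
   Leibniz equality is equality of subspaces. *)
Definition subspace (k : nat) : finType :=
  {A : 'M[F]_3 | (<<A>>%MS == A) && (\rank A == k)}.
Definition point : finType := subspace 1.
Definition line : finType := subspace 2.

Definition on_line (l : line) : {set point} :=
  [set P : point | (val P <= val l)%MS].

Definition vec3 (X Y Z : F) : 'rV[F]_3 := \row_j [:: X; Y; Z]`_j.

Definition has_coords (P : point) (X Y Z : F) : bool :=
  (val P == vec3 X Y Z)%MS.

(* kermx c is the space of row vectors v with v *m c = 0, here with c = (1,0,0)^T,
   i.e. the line X = 0. *)
Definition affine (P : point) : bool :=
  ~~ (val P <= kermx (vec3 1 0 0)^T)%MS.

Definition secant_number (A : {set point}) (l : line) : nat :=
  #|A :&: on_line l|.

Definition is_KM_arc (t : nat) (A : {set point}) : Prop :=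
  [/\ #|A| = (#|F| + t)%N,
      forall l : line, secant_number A l \in [:: 0; 2; t]%N
    & forall n : nat, n \in [:: 0; 2; t]%N ->
        exists l : line, secant_number A l = n].

Definition is_hyperoval (A : {set point}) : Prop := is_KM_arc 2 A.

Definition is_collineation (s : {perm point}) : Prop :=
  forall l : line, exists m : line, s @: on_line l = on_line m.

(* The identity counts as an elation. *)
Definition is_elation (l : line) (R : point) (s : {perm point}) : Prop :=
  [/\ R \in on_line l,
      is_collineation s,
      forall P : point, P \in on_line l -> s P = P
    & forall m : line, R \in on_line m -> s @: on_line m = on_line m].

Definition is_elation_with_axis (l : line) (s : {perm point}) : Prop :=
  exists R : point, is_elation l R s.

Definition stabilises (s : {perm point}) (A : {set point}) : Prop :=
  s @: A = A.

Definition is_elation_line (t : nat) (A : {set point}) (linf : line) : Prop :=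
  (t = 2%N /\
   exists s : {perm point},
     [/\ s != 1%g, is_elation_with_axis linf s & stabilises s A])
  \/
  ((2 < t)%N /\
   forall l : line, secant_number A l = t -> l <> linf ->
   forall P Q : point, P \in A :&: on_line l -> Q \in A :&: on_line l ->
   exists s : {perm point},
     [/\ is_elation_with_axis linf s, stabilises s A & s P = Q]).

Definition is_elation_KM_arc (t : nat) (A : {set point}) : Prop :=
  is_KM_arc t A /\ exists linf : line, is_elation_line t A linf.

Definition is_o_polynomial (g : {poly F}) : Prop :=
  is_hyperoval
    [set P : point | [exists x : F, has_coords P 1 g.[x] x]
                     || has_coords P 0 1 0 || has_coords P 0 0 1].

End ProjectivePlane.

(* In a field extension F of K, c%:A is the image in F of the scalar c : K, and
   1%VS is K inside F, so that galTrace is the trace from F to K.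
   finvect_type F is F with its finite field structure. *)
Definition is_relative_trace (K : finFieldType) (F : fieldExtType K)
    (L : finvect_type F -> K) : Prop :=
  forall x : finvect_type F,
    (L x)%:A = galTrace 1%VS {:finvect_type F} x.

Definition KM_affine_points (K : finFieldType) (F : fieldExtType K)
    (L : finvect_type F -> K) (g : {poly K}) : {set point (finvect_type F)} :=
  [set P : point (finvect_type F) |
    [exists x : finvect_type F,
      has_coords P 1 (g.[L x]%:A : finvect_type F) x]].

(* Main.v *)
(* If L k = 0, the elation (X,Y,Z) |-> (X,Y,Z+kX) with axis X = 0 and centre
   (0,0,1) permutes the affine points (1,g(L x),x) and fixes the points on X = 0,
   so it stabilises A.  As g is injective, the points of A on the line
   Y = g(L x) X include the (1,g(L x),x+k) with L k = 0, an orbit of these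
   elations; |ker L| >= q/q' = 2^i makes this line a 2^i-secant without further
   points of A.  If 2^i > 2, counting A along the lines through a point of A
   shows that the point lies on only one 2^i-secant, so all 2^i-secants other
   than X = 0 are of this form. *)
Require Import Defs.
From mathcomp Require Import all_boot all_order all_fingroup all_algebra all_field.
From mathcomp Require Import zify.

Set Implicit Arguments.
Unset Strict Implicit.
Unset Printing Implicit Defensive.

Import GRing.Theory.
Local Open Scope ring_scope.

Section Incidence.
Variable F : finFieldType.
Implicit Types (P Q : point F) (l m : line F).

(** * Row spaces, coordinates and incidence *)

Lemma subspace_inj k (S T : subspace F k) : (val S :=: val T)%MS -> S = T.
Proof.
move=> eST; apply: val_inj.
have /andP[/eqP eS _] := valP S; have /andP[/eqP eT _] := valP T.
by rewrite -eS -eT; apply/genmxP; apply/eqmxP.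
Qed.

Lemma rank_subspace k (S : subspace F k) : \rank (val S) = k.
Proof. by have /andP[_ /eqP] := valP S. Qed.

Lemma subspace_of_mx k n (B : 'M[F]_(n, 3)) :
  \rank B = k -> exists S : subspace F k, (val S :=: B)%MS.
Proof.
move=> rB.
have BP : (<< <<B>> >>%MS == <<B>>%MS) && (\rank <<B>>%MS == k).
  by rewrite genmx_id eqxx genmxE rB eqxx.
by exists (Sub <<B>>%MS BP); rewrite SubK; apply: genmxE.
Qed.

Lemma vec3_eq0 (X Y Z : F) : (vec3 X Y Z == 0) = [&& X == 0, Y == 0 & Z == 0].
Proof.
apply/eqP/and3P => [/rowP v0 | [/eqP-> /eqP-> /eqP->]].
  by split; apply/eqP;
    [move: (v0 0) | move: (v0 1) | move: (v0 (inord 2))]; rewrite !mxE ?inordK.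
by apply/rowP => -[[|[|[|j]]] ltj] //; rewrite !mxE.
Qed.

Lemma vec3_dot (X Y Z X' Y' Z' : F) :
  (vec3 X Y Z *m (vec3 X' Y' Z')^T == 0) = (X * X' + Y * Y' + Z * Z' == 0).
Proof.
have e00 : (vec3 X Y Z *m (vec3 X' Y' Z')^T) 0 0 = X * X' + Y * Y' + Z * Z'.
  by rewrite !mxE !big_ord_recl big_ord0 !mxE /= addr0 addrA.
rewrite -e00; apply/eqP/eqP => [-> | e0]; first by rewrite mxE.
by apply/matrixP => i j; rewrite !ord1 e0 mxE.
Qed.

Lemma vec3D (X Y Z X' Y' Z' : F) :
  vec3 X Y Z + vec3 X' Y' Z' = vec3 (X + X') (Y + Y') (Z + Z').
Proof. by apply/rowP => -[[|[|[|j]]] ltj] //; rewrite !mxE. Qed.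

Lemma scale_vec3 (a X Y Z : F) : a *: vec3 X Y Z = vec3 (a * X) (a * Y) (a * Z).
Proof. by apply/rowP => -[[|[|[|j]]] ltj] //; rewrite !mxE. Qed.

Lemma point_of_coords (X Y Z : F) :
  vec3 X Y Z != 0 -> exists P, has_coords P X Y Z.
Proof.
move=> vn0; have [|P eP] := @subspace_of_mx 1 _ (vec3 X Y Z).
  by rewrite rank_rV vn0.
by exists P; apply/eqmxP.
Qed.

Lemma line_of_covec (v : 'rV[F]_3) :
  v != 0 -> exists l, (val l :=: kermx v^T)%MS.
Proof.
by move=> vn0; apply: subspace_of_mx; rewrite mxrank_ker mxrank_tr rank_rV vn0.
Qed.

Lemma has_coords_inj P Q (X Y Z : F) :
  has_coords P X Y Z -> has_coords Q X Y Z -> P = Q.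
Proof.
move=> /eqmxP eP /eqmxP eQ; apply: subspace_inj.
exact: eqmx_trans eP (eqmx_sym eQ).
Qed.

Lemma on_line_covec P l (X Y Z a b c : F) :
    has_coords P X Y Z -> (val l :=: kermx (vec3 a b c)^T)%MS ->
  (P \in on_line l) = (X * a + Y * b + Z * c == 0).
Proof.
move=> /eqmxP eP el.
by rewrite inE el eP sub_kermx vec3_dot.
Qed.

Lemma has_coords_1E P (y z y' z' : F) :
  has_coords P 1 y z -> has_coords P 1 y' z' -> y = y' /\ z = z'.
Proof.
move=> /eqmxP eP /eqmxP eP'.
have : (vec3 1 y z <= vec3 1 y' z')%MS by rewrite -eP eP'.
(* The first coordinates, both 1, force the scaling factor [a] to be 1. *)
case/sub_rVP => a; rewrite scale_vec3 => /rowP ea.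
have := ea 0; have := ea 1; have := ea (inord 2).
by rewrite !mxE !inordK //= !mulr1 => e2 e1 e0; rewrite e2 e1 -e0 !mul1r.
Qed.

Lemma affine_has_coords_1 P (y z : F) : has_coords P 1 y z -> affine P.
Proof.
by move=> /eqmxP eP; rewrite /affine eP sub_kermx vec3_dot !mulr0 mulr1 !addr0 oner_eq0.
Qed.

(** * Lines through one or two points, and $t$-secants *)

Lemma line_unique P Q l m : P != Q ->
    P \in on_line l -> Q \in on_line l ->
    P \in on_line m -> Q \in on_line m -> l = m.
Proof.
move=> neqPQ; rewrite !inE => Pl Ql Pm Qm.
have ltPQ : (1 < \rank (val P + val Q)%MS)%N.
  rewrite ltnNge; apply: contra neqPQ => lePQ1; apply/eqP.
  apply: subspace_inj; apply: (@eqmx_trans _ _ _ _ _ _ (val P + val Q)%MS).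
    apply/eqmxP; rewrite -(geq_leqif (mxrank_leqif_eq (addsmxSl _ _))).
    by rewrite rank_subspace.
  apply: eqmx_sym; apply/eqmxP.
  rewrite -(geq_leqif (mxrank_leqif_eq (addsmxSr _ _))).
  by rewrite rank_subspace.
have join_line (n : line F) : (val P <= val n)%MS -> (val Q <= val n)%MS ->
    (val n :=: val P + val Q)%MS.
  move=> Pn Qn; apply: eqmx_sym; apply/eqmxP.
  have PQn : (val P + val Q <= val n)%MS by rewrite addsmx_sub Pn.
  by rewrite -(geq_leqif (mxrank_leqif_eq PQn)) rank_subspace.
apply: subspace_inj; apply: eqmx_trans (join_line l Pl Ql) _.
exact: eqmx_sym (join_line m Pm Qm).
Qed.

Lemma card_lines_through P :
  (#|F|.+1 <= #|[set l : line F | P \in on_line l]|)%N.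
Proof.
(* [B] is invertible and its first row spans the same space as [p], that is, P. *)
pose p := nz_row (val P); pose B := row_ebase p.
have pn0 : p != 0.
  by rewrite nz_row_eq0 -mxrank_eq0 rank_subspace.
have eP : (val P :=: p)%MS.
  apply: eqmx_sym; apply/eqmxP.
  by rewrite -(geq_leqif (mxrank_leqif_eq (nz_row_sub _))) rank_subspace rank_rV pn0.
have Bu : B \in unitmx := row_ebase_unit p.
(* With respect to the rows of B, the point P is (1,0,0) and w enumerates the
   normalised equations of the lines through it. *)
pose w (o : option F) : 'rV[F]_3 := if o is Some a then vec3 0 a 1 else vec3 0 1 0.
have ex_l o : exists l, (val l == kermx (invmx B *m (w o)^T))%MS.
  have [|l el] := @line_of_covec (invmx B *m (w o)^T)^T.
    rewrite -mxrank_eq0 trmx_mul mxrankMfree ?row_free_unit ?unitmx_tr ?unitmx_inv // trmxK.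
    by rewrite rank_rV /w; case: (o) => [a|]; rewrite vec3_eq0 oner_eq0 ?andbF.
  by exists l; apply/eqmxP; rewrite trmxK in el.
pose f o := xchoose (ex_l o).
have ef o : (val (f o) :=: kermx (invmx B *m (w o)^T))%MS.
  by apply/eqmxP; apply: (xchooseP (ex_l o)).
have on_f n (v : 'M_(n, 3)) o : (v *m B <= val (f o))%MS = (v *m (w o)^T == 0).
  by rewrite ef sub_kermx mulmxA mulmxK.
have f_inj : injective f.
  suff neq_f a o : o != Some a -> f (Some a) != f o.
    case=> [a|] [b|] // eab; apply/esym/eqP; apply: contraTT isT => neq.
    - by have := neq_f _ _ neq; rewrite eab eqxx.
    - by have := neq_f a None isT; rewrite eab eqxx.
    - by have := neq_f b None isT; rewrite eab eqxx.
  move=> neq_o; apply/eqP => ef_o.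
  (* In these coordinates (0,-1,a) lies on [f (Some a)], but on [f (Some b)] only if b = a, and
     never on [f None]. *)
  have := on_f _ (vec3 0 (- 1) a) (Some a); rewrite ef_o on_f /w.
  case: o neq_o {ef_o} => [b|] neq_o; rewrite !vec3_dot.
    rewrite !mulr0 !mulr1 !add0r !mulN1r addNr eqxx addrC subr_eq0 => /eqP eab.
    by rewrite eab eqxx in neq_o.
  by rewrite !mulr0 !mulr1 !add0r !mulN1r addNr addr0 eqxx oppr_eq0 oner_eq0.
rewrite -card_option -(card_imset _ f_inj).
apply: subset_leq_card; apply/subsetP => _ /imsetP[o _ ->].
rewrite !inE eP -[p in (p <= _)%MS]mulmx_ebase -/B on_f -mulmxA rank_rV pn0.
have -> : pid_mx true = vec3 1 0 0 :> 'rV[F]_3.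
  by apply/rowP => -[[|[|[|j]]] ltj] //; rewrite !mxE.
suff -> : vec3 1 0 0 *m (w o)^T = 0 by rewrite mulmx0.
by apply/eqP; rewrite /w; case: (o) => [a|]; rewrite vec3_dot !mulr0 !mul0r !addr0.
Qed.

(** Two $t$-secants on P would carry 2(t - 1) further points of A, and each of the at least q - 1
    other lines through P at least one more; but 2(t - 1) + (q - 1) > q + t - 1 once t > 2. *)
Lemma t_secant_unique t (A : {set point F}) P l m :
    is_KM_arc t A -> (2 < t)%N -> P \in A -> P \in on_line l -> P \in on_line m ->
  secant_number A l = t -> secant_number A m = t -> l = m.
Proof.
move=> [cA sA _] t2 PA Pl Pm sl sm; apply/eqP; apply: contraTT isT => neq_lm.
pose S := [set n : line F | P \in on_line n].
pose D n := (A :&: on_line n) :\ P.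
have cD n : n \in S -> secant_number A n = #|D n|.+1.
  by rewrite inE => Pn; rewrite /secant_number (cardsD1 P) inE PA Pn.
(* A point of A other than P lies on at most one line through P, so the sets [D n] are disjoint. *)
have sumD : (\sum_(n in S) #|D n| <= #|A :\ P|)%N.
  rewrite (eq_bigr (fun n => \sum_(Q in A :\ P) if Q \in on_line n then 1 else 0)%N).
    rewrite exchange_big -sum1_card leq_sum // => Q /setD1P[neqQP QA].
    rewrite -big_mkcondr sum1_card; apply/card_le1_eqP => n1 n2.
    move=> /andP[+ Q1] /andP[+ Q2]; rewrite ![_ \in S]in_set => P1 P2.
    exact: (line_unique neqQP Q2 P2 Q1 P1).
  move=> n _; rewrite -big_mkcondr sum1_card; apply: eq_card => Q.
  by rewrite -[RHS]/((Q \in A :\ P) && (Q \in on_line n)) !inE andbA.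
(* A line through P has a nonzero secant number, so one of at least 2. *)
have D1 n : n \in S -> (1 <= #|D n|)%N.
  by move=> nS; have := sA n; rewrite cD // !inE; lia.
have lS : l \in S by rewrite inE.
have mS : m \in S by rewrite inE.
have cAP := cardsD1 P A; have cS := card_lines_through P; rewrite -/S in cS.
rewrite PA cA in cAP.
have mSl : m \in S :\ l by rewrite in_setD1 mS andbT eq_sym.
have : (#|S :\ l :\ m| <= \sum_(n in S :\ l :\ m) #|D n|)%N.
  rewrite -sum1_card; apply: leq_sum => n; rewrite !in_setD1 => /and3P[_ _].
  exact: D1.
move: sumD; rewrite (big_setD1 l lS) (big_setD1 m mSl) /=.
have := cardsD1 l S; have := cardsD1 m (S :\ l); rewrite mSl lS.
have := cD _ lS; have := cD _ mS; rewrite sl sm.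
move: cS cAP; rewrite !add1n.
move: (#|A :\ P|) (\sum_(i in _) _)%N (#|D l|) (#|D m|) => a x y z.
move: (#|S|) (#|S :\ l|) (#|S :\ l :\ m|) => s b c.
lia.
Qed.

(** * Collineations given by matrices, and elations *)

Lemma mx_collineation (B : 'M[F]_3) : B \in unitmx ->
  exists s : {perm point F}, forall P, (val (s P) :=: val P *m B)%MS.
Proof.
move=> Bu.
have ex_f P : exists Q : point F, (val Q == val P *m B)%MS.
  have [|Q eQ] := @subspace_of_mx 1 _ (val P *m B).
    by rewrite mxrankMfree ?row_free_unit // rank_subspace.
  by exists Q; apply/eqmxP.
pose f P := xchoose (ex_f P).
have ef P : (val (f P) :=: val P *m B)%MS by apply/eqmxP; apply: (xchooseP (ex_f P)).
have f_inj : injective f.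
  move=> P Q ePQ; apply: subspace_inj.
  rewrite -[val P](mulmxK Bu) -[val Q](mulmxK Bu); apply: eqmxMr.
  by apply: eqmx_trans (ef Q); rewrite -ePQ; apply: eqmx_sym.
by exists (perm f_inj) => P; rewrite permE; apply: ef.
Qed.

Lemma mx_collineation_line (B : 'M[F]_3) (s : {perm point F}) l m :
    B \in unitmx -> (forall P, (val (s P) :=: val P *m B)%MS) ->
  (val m :=: val l *m B)%MS -> s @: on_line l = on_line m.
Proof.
move=> Bu sE em; apply/setP => Q; rewrite -[Q](permKV s) mem_imset; last exact: perm_inj.
by rewrite !inE sE em submxMfree // row_free_unit.
Qed.

Lemma mx_is_collineation (B : 'M[F]_3) (s : {perm point F}) :
  B \in unitmx -> (forall P, (val (s P) :=: val P *m B)%MS) -> is_collineation s.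
Proof.
move=> Bu sE l; have [|m em] := @subspace_of_mx 2 _ (val l *m B).
  by rewrite mxrankMfree ?row_free_unit // rank_subspace.
by exists m; apply: (mx_collineation_line Bu sE).
Qed.

Lemma elation_exists (linf : line F) (k : F) :
    (val linf :=: kermx (vec3 1 0 0)^T)%MS ->
  exists s : {perm point F},
    [/\ is_elation_with_axis linf s,
        forall P, ~~ affine P -> s P = P
      & forall P (y z : F), has_coords P 1 y z -> has_coords (s P) 1 y (z + k)].
Proof.
move=> einf.
pose e0 : 'rV[F]_3 := vec3 1 0 0; pose e2 : 'rV[F]_3 := vec3 0 0 1.
(* On row vectors [N a] is (X,Y,Z) -> (X,Y,Z + aX); its inverse is [N (- a)], because [e2 *m e0^T]
   vanishes. *)
pose N (a : F) := 1%:M + a *: (e0^T *m e2).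
have NE n (v : 'M_(n, 3)) a : v *m N a = v + a *: (v *m e0^T *m e2).
  by rewrite mulmxDr mulmx1 -scalemxAr mulmxA.
have e20 : e2 *m e0^T = 0 by apply/eqP; rewrite vec3_dot !(mulr0, mul0r) !addr0.
have Nu : N k \in unitmx.
  suff : N k *m N (- k) = 1%:M by case/mulmx1_unit.
  rewrite NE {2}/N mulmxDl mul1mx -scalemxAl -(mulmxA e0^T) e20 mulmx0 scaler0.
  by rewrite addr0 /N scaleNr addrK.
have [s sE] := mx_collineation Nu.
have sfix P : ~~ affine P -> s P = P.
  rewrite negbK sub_kermx => /eqP P0; apply: subspace_inj.
  by apply: eqmx_trans (sE P) _; rewrite NE P0 mul0mx scaler0 addr0.
exists s; split=> //; last first.
  move=> P y z /eqmxP eP; apply/eqmxP; apply: eqmx_trans (sE P) _.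
  apply: eqmx_trans (eqmxMr _ eP) _; rewrite NE.
  have -> : vec3 1 y z *m e0^T = 1%:M.
    apply/matrixP => i j; rewrite !ord1 !mxE !big_ord_recl big_ord0 !mxE /=.
    by rewrite !mulr0 mulr1 !addr0.
  by rewrite mul1mx scale_vec3 vec3D !mulr0 mulr1 !addr0.
have [|R eR] := @point_of_coords 0 0 1; first by rewrite vec3_eq0 oner_eq0 !andbF.
exists R; split.
- by rewrite (on_line_covec eR einf) !(mulr0, mul0r) !addr0.
- exact: mx_is_collineation Nu sE.
- by move=> P; rewrite inE einf => P0; apply: sfix; rewrite negbK.
move=> m; rewrite inE (eqmxP eR) => Rm.
apply: (mx_collineation_line Nu sE); apply: eqmx_sym; apply/eqmxP.
(* Applying [N k] changes a vector by a multiple of [e2], which spans the centre R on m. *)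
have mN : (val m *m N k <= val m)%MS.
  by rewrite NE addmx_sub // scalemx_sub // mulmx_sub.
rewrite -(geq_leqif (mxrank_leqif_eq mN)).
by rewrite mxrankMfree ?row_free_unit.
Qed.

(** * Elations of KM-arcs with translation-invariant affine part *)

(** Here [f] stands for g(L(x)). The condition on [f] makes its fibres the cosets of the subgroup
    [W] of all k with f k = f 0, and adding such k to Z permutes the affine points of A. *)
Lemma translation_invariant_KM_arc t (A : {set point F}) (f : F -> F) :
    (1 < t)%N -> is_KM_arc t A ->
    [set P in A | affine P] = [set P | [exists x, has_coords P 1 (f x) x]] ->
    (forall x y, (f x == f y) = (f (y - x) == f 0)) ->
    (t <= #|[set k | f k == f 0%R]|)%N ->
  is_elation_KM_arc t A.
Proof.
move=> t1 kmA affA fB cW; pose W := [set k | f k == f 0]; rewrite -/W in cW.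
have fD x k : k \in W -> f (x + k) = f x.
  by rewrite inE => fk; apply/esym/eqP; rewrite fB addrC addKr.
have [|linf einf] := @line_of_covec (vec3 1 0 0); first by rewrite vec3_eq0 oner_eq0.
have inA P x : has_coords P 1 (f x) x -> P \in A.
  move=> eP; suff : P \in [set P in A | affine P] by rewrite inE => /andP[].
  by rewrite affA inE; apply/existsP; exists x.
have A_affine P : P \in A -> affine P -> exists x, has_coords P 1 (f x) x.
  move=> PA aP; have : P \in [set P in A | affine P] by rewrite inE PA.
  by rewrite affA inE => /existsP.
have elationW k : k \in W -> exists s : {perm point F},
    [/\ is_elation_with_axis linf s, stabilises s A
      & forall P (y z : F), has_coords P 1 y z -> has_coords (s P) 1 y (z + k)].
  move=> kW; have [s [els sfix sE]] := elation_exists k einf; exists s; split=> //.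
  (* Since [s] is injective, inclusion of the image in A already gives equality. *)
  apply/eqP; rewrite eqEcard card_imset ?leqnn ?andbT; last exact: perm_inj.
  apply/subsetP => _ /imsetP[P PA ->]; case: (boolP (affine P)) => aP; last by rewrite sfix.
  have [x eP] := A_affine P PA aP.
  by apply: (@inA _ (x + k)); rewrite fD //; apply: sE.
have ex_pt y z : exists P, has_coords P 1 y z.
  by apply: point_of_coords; rewrite vec3_eq0 oner_eq0.
pose pt y z := xchoose (ex_pt y z).
have ptE y z : has_coords (pt y z) 1 y z by apply: (xchooseP (ex_pt y z)).
split=> //; exists linf; case: (ltngtP t 2) => [| t2 | t2]; first by lia.
  right; split=> // l sl neql P Q Pl Ql.
  (* Otherwise all t > 2 points of A on l would lie on X = 0, which meets l in at most one point. *)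
  have [P0 P0Al aP0] : exists2 P0, P0 \in A :&: on_line l & affine P0.
    apply/exists_inP; apply: contraTT t2 => /exists_inPn all_inf.
    suff : (#|A :&: on_line l| <= 1)%N by rewrite -[#|_|]/(secant_number A l) sl; lia.
    have on_inf R : R \in A :&: on_line l -> R \in on_line linf.
      by move/all_inf; rewrite negbK inE einf.
    apply/card_le1_eqP => R1 R2 R1l R2l.
    apply/eqP; apply: contraTT isT => neqR; case: neql.
    move: (R1l) (R2l); rewrite !in_setI => /andP[_ l1] /andP[_ l2].
    by apply: (line_unique neqR); rewrite ?on_inf.
  move: P0Al; rewrite in_setI => /andP[P0A P0l].
  have [x eP0] := A_affine _ P0A aP0.
  (* [l0] is the line Y = f(x)X, joining [P0] to the centre (0,0,1); [B] is the orbit of [P0] under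
     the elations from [W]. *)
  have [|l0 el0] := @line_of_covec (vec3 (- f x) 1 0).
    by rewrite vec3_eq0 oner_eq0 andbF.
  pose B := [set pt (f x) (x + k) | k in W].
  have cB : #|B| = #|W|.
    apply: card_imset => k1 k2 e12; apply: (addrI x).
    by have := ptE (f x) (x + k1); rewrite e12 => /has_coords_1E/(_ (ptE _ _))[].
  have sB : B \subset A :&: on_line l0.
    apply/subsetP => _ /imsetP[k kW ->]; rewrite in_setI.
    rewrite (on_line_covec (ptE _ _) el0) mul1r mulr1 mulr0 addr0 addNr eqxx andbT.
    by apply: (@inA _ (x + k)); rewrite fD //; apply: ptE.
  (* The |W| >= t > 2 points of [B] on [l0] leave t as the only possible secant number, so [B] is
     all of the intersection. *)
  have sl0 : secant_number A l0 = t.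
    case: kmA => _ /(_ l0) + _; have := subset_leq_card sB; rewrite cB !inE.
    by rewrite -[#|A :&: _|]/(secant_number A l0); lia.
  have eB : B = A :&: on_line l0.
    apply/eqP; rewrite eqEcard sB cB; apply: leq_trans cW.
    by rewrite -[#|A :&: _|]/(secant_number A l0) sl0.
  have ll0 : l = l0.
    apply: (t_secant_unique kmA t2 P0A) => //.
    by rewrite (on_line_covec eP0 el0) mul1r mulr1 mulr0 addr0 addNr.
  move: Pl Ql; rewrite ll0 -eB => /imsetP[k1 k1W ->] /imsetP[k2 k2W ->].
  (* The elation for k2 - k1 takes Z = x + k1 to Z = x + k2. *)
  have [|s [els sA sE]] := elationW (k2 - k1).
    by move: k1W k2W; rewrite !inE -fB => /eqP-> /eqP->.
  exists s; split=> //; apply: has_coords_inj (ptE _ _).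
  by have := sE _ _ _ (ptE (f x) (x + k1)); rewrite -addrA [k1 + _]addrC subrK.
left; split=> //.
(* For t = 2 the set [W] has at least two elements, hence a nonzero one. *)
have [k kW kn0] : exists2 k, k \in W & k != 0.
  apply/exists_inP; apply: contraTT cW => /exists_inPn W0.
  rewrite -ltnNge t2 ltnS -(cards1 (0 : F)); apply: subset_leq_card.
  by apply/subsetP => k /W0; rewrite negbK inE.
have [s [els sA sE]] := elationW k kW; exists s; split=> //.
(* The elation is not the identity, as it moves (1,0,0) to (1,0,k). *)
apply: contraNneq kn0 => s1; have := sE _ _ _ (ptE 0 0).
by rewrite s1 perm1 add0r => /has_coords_1E/(_ (ptE _ _))[_ ->].
Qed.

(** * Injectivity of $o$-polynomials and the kernel of the trace *)

(** If g(a) = g(b) with a and b distinct, the line Y = g(a)X would meet the hyperoval in the three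
    points (0,0,1), (1,g(a),a) and (1,g(b),b). *)
Lemma o_polynomial_inj (g : {poly F}) : is_o_polynomial g -> injective (horner g).
Proof.
case; set H := [set P | _] => _ sH _ a b eab.
apply/eqP; apply: contraTT isT => neqab.
have ex_pt z : exists P, has_coords P 1 g.[a] z.
  by apply: point_of_coords; rewrite vec3_eq0 oner_eq0.
have [P eP] := ex_pt a; have [Q eQ] := ex_pt b.
have [|R eR] := @point_of_coords 0 0 1; first by rewrite vec3_eq0 oner_eq0 !andbF.
have [|l el] := @line_of_covec (vec3 (- g.[a]) 1 0).
  by rewrite vec3_eq0 oner_eq0 andbF.
have neqPQ : P != Q.
  by apply: contraNneq neqab => ePQ; rewrite ePQ in eP; case: (has_coords_1E eP eQ) => _ ->.
have nR : ~~ affine R.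
  by rewrite negbK (eqmxP eR) sub_kermx vec3_dot !(mulr0, mul0r) !addr0.
have neqR S z : has_coords S 1 g.[a] z -> R != S.
  by move/affine_has_coords_1=> aS; apply: contraNneq nR => ->.
have sub3 : [set R; P; Q] \subset H :&: on_line l.
  apply/subsetP => S; rewrite !in_setU !in_set1 in_setI => /orP[/orP[]|] /eqP->.
  - by rewrite (on_line_covec eR el) inE eR orbT !(mulr0, mul0r) !addr0 eqxx.
  - rewrite (on_line_covec eP el) mul1r mulr1 mulr0 addr0 addNr eqxx andbT inE.
    by apply/orP; left; apply/orP; left; apply/existsP; exists a.
  - rewrite (on_line_covec eQ el) mul1r mulr1 mulr0 addr0 addNr eqxx andbT inE.
    by apply/orP; left; apply/orP; left; apply/existsP; exists b; rewrite -eab.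
have := subset_leq_card sub3; rewrite -setUA cardsU1 cards2 neqPQ.
rewrite !inE !negb_or (neqR _ _ eP) (neqR _ _ eQ).
by have := sH l; rewrite /secant_number !inE; lia.
Qed.

End Incidence.

(** Every nonempty fibre of [f] is moved into the kernel by subtracting one of its elements, and
    there are at most |V| fibres. *)
Lemma leq_card_kernel (U V : finZmodType) (f : U -> V) :
  {morph f : x y / x - y} -> (#|U| <= #|[set k | f k == 0%R]| * #|V|)%N.
Proof.
move=> fB; rewrite -[leqLHS]sum1_card (partition_big f predT) //=.
apply: (@leq_trans (\sum_(v : V) #|[set k | f k == 0%R]|)); last first.
  by rewrite sum_nat_const [leqRHS]mulnC.
apply: leq_sum => v _; rewrite sum1_card.
have [x /eqP fx|no_x] := pickP [pred x | f x == v]; last first.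
  by rewrite eq_card0 // => x; rewrite inE /= [_ == v]no_x.
rewrite -(card_imset _ (addIr (- x))); apply: subset_leq_card.
apply/subsetP => _ /imsetP[y /eqP fy ->].
by rewrite inE fB fx fy subrr.
Qed.

Theorem lemma2p3 (h i : nat) (hi1 : (1 <= i)%N) (hih : (i < h)%N)
  (hdvd : (h - i %| h)%N)
  (K : finFieldType) (cardK : #|K| = (2 ^ (h - i))%N)
  (F : fieldExtType K) (cardF : #|finvect_type F| = (2 ^ h)%N)
  (L : finvect_type F -> K) (trL : is_relative_trace L)
  (g : {poly K}) (og : is_o_polynomial g)
  (A : {set point (finvect_type F)})
  (kmA : is_KM_arc (2 ^ i) A)
  (affA : [set P in A | affine P] = KM_affine_points L g) :
  is_elation_KM_arc (2 ^ i) A.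
Proof.
have algI : injective (fun a : K => a%:A : finvect_type F).
  by move=> a b; apply: (fmorph_inj (in_alg F)).
(* Additivity passes from [galTrace] to [L] through the injective embedding of K in F. *)
have LB : {morph L : x y / x - y}.
  by move=> x y; apply: algI; rewrite /= scalerBl !trL raddfB.
have L0 : L 0 = 0 by rewrite -(subrr 0) LB subrr.
have g_inj := o_polynomial_inj og.
have fE (x y : finvect_type F) :
    (g.[L x]%:A == g.[L y]%:A :> finvect_type F) = (L x == L y).
  by rewrite (inj_eq algI) (inj_eq g_inj).
apply: (translation_invariant_KM_arc _ kmA affA).
- by rewrite -{1}(expn0 2) ltn_exp2l.
- by move=> x y; rewrite !fE LB L0 subr_eq0 eq_sym.
(* By injectivity of g, [W] is the kernel of L; cancel 2^(h-i) in 2^h <= |W| 2^(h-i). *)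
under eq_finset do rewrite fE L0.
have := leq_card_kernel LB; rewrite cardF cardK.
by rewrite -{1}(subnK (ltnW hih)) addnC expnD leq_pmul2r // expn_gt0.
Qed.
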